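(* Let $x\in C[0,1]$ be a nonconstant continuous real-valued function. (1) Suppose that the Faber--Schauder coefficients of $x$ satisfy the reverse Jensen condition. Then $x$ admits a roughness exponent $R$ if and only if $\widehat R_n(x)\to R$ as $n\uparrow\infty$. (2) Conversely, suppose that $\widehat R_n(x)$ converges to the roughness exponent $R$ of $x$. Then the reverse Jensen inequalities hold at $p=1/R$; that is, for $p=1/R$ there exist $n_p\in\mathbb N$ and a non-decreasing subexponential function $\varrho_p:\mathbb N\to[1,\infty)$ such that $$\frac1{\varrho_p(n)} s_n^p\le \frac1{2^{n-1}}\sum_{k=0}^{2^{n-1}-1}\Big(\sum_{m=0}^{n-1}2^m\theta^2_{m,\lfloor 2^{m-n+1}k\rfloor}\Big)^{p/2}\le\varrho_p(n)s_n^{p}\qquad\text{for } n\ge n_p.$$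
   Context: For $p>0$ and $n\in\mathbb N$, let $\langle x\rangle_n^{(p)}:=\sum_{k=0}^{2^n-1}|x((k+1)2^{-n})-x(k2^{-n})|^p$. The function $x$ admits the roughness exponent $R:=1/q$ (with $1/\infty:=0$) if there exists $q\in[1,\infty]$ such that $\lim_{n}\langle x\rangle_n^{(p)}=0$ for $p>q$ and $\lim_n\langle x\rangle_n^{(p)}=\infty$ for $p<q$. The Faber--Schauder coefficients of $x$ are $\theta_{m,k}:=2^{m/2}\big(2x(\tfrac{2k+1}{2^{m+1}})-x(\tfrac{k}{2^m})-x(\tfrac{k+1}{2^m})\big)$ for $m\in\mathbb N_0$, $k=0,\dots,2^m-1$. For $n\in\mathbb N$ set $s_n:=\sqrt{\sum_{m=0}^{n-1}\sum_{k=0}^{2^m-1}\theta_{m,k}^2}$ and $\widehat R_n(x):=1-\frac1n\log_2 s_n$. A function $\varrho$ is subexponential if $\frac1t\log\varrho(t)\to0$ as $t\uparrow\infty$. The Faber--Schauder coefficients of $x$ satisfy the reverse Jensen condition if for each $p\ge1$ there exist $n_p\in\mathbb N$ and a non-decreasing subexponential function $\varrho_p:\mathbb N\to[1,\infty)$ such that $$\frac1{\varrho_p(n)} s_n^p\le \frac1{2^{n-1}}\sum_{k=0}^{2^{n-1}-1}\Big(\sum_{m=0}^{n-1}2^m\theta^2_{m,\lfloor 2^{m-n+1}k\rfloor}\Big)^{p/2}\le\varrho_p(n)s_n^{p}\qquad\text{for } n\ge n_p.$$ *)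

(* Defs.v *)
From mathcomp Require Import all_boot all_order all_algebra.
From mathcomp Require Import all_classical all_reals all_analysis.

Set Implicit Arguments.
Unset Strict Implicit.
Unset Printing Implicit Defensive.

Import Order.TTheory GRing.Theory Num.Theory.
Import numFieldNormedType.Exports.

Local Open Scope classical_set_scope.
Local Open Scope ring_scope.

(* [powR 0 a = 0] for a != 0, [ln 0 = 0], and [0^-1 = 0] in the real field.
   A function [x : R -> R] is only ever evaluated on [0, 1]. *)

Definition pvariation (R : realType) (x : R -> R) (p : R) (n : nat) : R :=
  \sum_(k < 2 ^ n) `|x (k.+1%:R / 2 ^+ n) - x (k%:R / 2 ^+ n)| `^ p.

(* The critical exponent q ranges over the extended reals [1, +oo]; the
   extended inverse satisfies [+oo^-1 = 0]. *)
Definition admits_roughness_exponent (R : realType) (x : R -> R) (r : R) :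
    Prop :=
  exists q : \bar R,
    [/\ (1 <= q)%E,
        r%:E = (q^-1)%E,
        (forall p : R, 0 < p -> (q < p%:E)%E ->
           pvariation x p n @[n --> \oo] --> (0 : R)) &
        (forall p : R, 0 < p -> (p%:E < q)%E ->
           pvariation x p n @[n --> \oo] --> +oo)].

Definition faber_schauder (R : realType) (x : R -> R) (m k : nat) : R :=
  2 `^ (m%:R / 2) *
  (2 * x ((2 * k + 1)%:R / 2 ^+ m.+1) - x (k%:R / 2 ^+ m)
   - x (k.+1%:R / 2 ^+ m)).

Definition fs_norm (R : realType) (x : R -> R) (n : nat) : R :=
  Num.sqrt (\sum_(m < n) \sum_(k < 2 ^ m) faber_schauder x m k ^+ 2).

(* If x is affine on the dyadic points then every [fs_norm x n] is 0 and, since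
   [ln 0 = 0], the estimate is 1; otherwise [fs_norm x n] is positive for all
   large n and the convention is irrelevant to the limit. *)
Definition roughness_estimate (R : realType) (x : R -> R) (n : nat) : R :=
  1 - n%:R^-1 * (ln (fs_norm x n) / ln 2).

Definition subexponential (R : realType) (f : nat -> R) : Prop :=
  n%:R^-1 * ln (f n) @[n --> \oo] --> (0 : R).

(* For m <= n - 1, the Euclidean quotient [k %/ 2 ^ (n.-1 - m)] is the floor of
   2^(m-n+1) k.  Used for n >= 1 only. *)
Definition fs_moment (R : realType) (x : R -> R) (p : R) (n : nat) : R :=
  (2 ^+ n.-1)^-1 *
  \sum_(k < 2 ^ n.-1)
    (\sum_(m < n) 2 ^+ m * faber_schauder x m (k %/ 2 ^ (n.-1 - m)) ^+ 2)
      `^ (p / 2).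

Definition reverse_jensen_at (R : realType) (x : R -> R) (p : R) : Prop :=
  exists (n_p : nat) (rho : nat -> R),
    [/\ (0 < n_p)%N,
        forall n, 1 <= rho n,
        {homo rho : m n / (m <= n)%N >-> m <= n},
        subexponential rho &
        forall n, (n_p <= n)%N ->
          (rho n)^-1 * fs_norm x n `^ p <= fs_moment x p n /\
          fs_moment x p n <= rho n * fs_norm x n `^ p].

Definition reverse_jensen_condition (R : realType) (x : R -> R) : Prop :=
  forall p : R, 1 <= p -> reverse_jensen_at x p.

(* Main.v *)
Require Import Defs.
From mathcomp Require Import all_boot all_order all_algebra.
From mathcomp Require Import all_classical all_reals all_analysis.
From mathcomp Require Import ring lra zify.

(** Write D_n(k) for the slope of x over the k-th dyadic interval of length
    2^-n. Passing from an interval to its halves changes the slope by + or - a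
    jump a_n(k) = 2^(n/2) theta_(n,k): the slopes form a dyadic martingale whose
    quadratic variation is Q_n = sum_(m < n) a_m^2. In these terms, with E the
    average over the dyadic intervals of a level,

      2^(n(p-1)) <x>_n^(p) = E |D_n|^p,    s_n^2 = E Q_n,

    and the reverse Jensen condition at p says that E Q_n^(p/2) and
    (E Q_n)^(p/2) agree up to a subexponential factor.

    The Burkholder inequality would compare E |D_n|^p with E Q_n^(p/2) up to
    constants. Since subexponential factors are free, a comparison up to powers
    of n is enough, and that is elementary. On the one hand
    |D_n| <= |D_0| + n Q_n^(1/2) pointwise ([slope_moment_le_fs_moment]). On the
    other hand a jump is half the difference of two slopes of the next level,
    and E |D_n|^p is nondecreasing in n for p >= 1 by convexity
    ([fs_moment_le_slope_moment]). Hence, for p >= 1, the reverse Jensen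
    inequalities at p hold if and only if

      ln <x>_n^(p) = n ln 2 (1 - p Rhat_n) + o(n)

    ([reverse_jensen_atP_pvariation]). If all the jumps vanish, both sides of
    this equivalence hold, because then x is affine on the dyadic points with a
    nonzero slope.

    For the first part, the p-th variation therefore decays or grows
    exponentially according to the sign of 1 - p lim Rhat_n, and conversely the
    behaviour of the p-th variation bounds Rhat_n from above and below by
    numbers arbitrarily close to R. The exponents p < 1, out of reach of the
    equivalence, are covered by the continuity of x
    ([pvariation_lt1_cvgy]).

    For the second part, truncating the increments at size 2^(-n/p) compares
    the variations at two exponents ([pvariation_interpolation]); applied on
    both sides of the critical exponent q = 1/R, this gives
    ln <x>_n^(q) = o(n) ([pvariation_critical_sublinear]). As 1 - q Rhat_n also
    tends to 0, the equivalence yields the reverse Jensen inequalities at q. *)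

Set Implicit Arguments.
Unset Strict Implicit.
Unset Printing Implicit Defensive.

Import Order.TTheory GRing.Theory Num.Theory.
Import numFieldNormedType.Exports.

Local Open Scope classical_set_scope.
Local Open Scope ring_scope.

(** * Averages over the dyadic intervals of a level *)

Lemma ler_sum_ord_cst (R : numDomainType) n (F : 'I_n -> R) (c : R) :
  (forall i, F i <= c) -> \sum_(i < n) F i <= n%:R * c.
Proof.
move=> Fc; apply: le_trans (ler_sum _ _) _ => [i _|]; first exact: Fc.
by rewrite sumr_const card_ord mulr_natl.
Qed.

Section DyadicMean.
Context {R : realType}.
Implicit Types f g : nat -> R.

Definition dyadic_mean n f : R := (2 ^+ n)^-1 * \sum_(k < 2 ^ n) f k.

Lemma dyadic_mean_ge0 n f : (forall k, 0 <= f k) -> 0 <= dyadic_mean n f.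
Proof. by move=> f0; rewrite mulr_ge0 ?invr_ge0 ?exprn_ge0 ?sumr_ge0. Qed.

Lemma dyadic_mean_gt0 n (f : nat -> R) k : (forall k, 0 <= f k) ->
  (k < 2 ^ n)%N -> 0 < f k -> 0 < dyadic_mean n f.
Proof.
move=> f0 kn fk; rewrite mulr_gt0 ?invr_gt0 ?exprn_gt0//.
rewrite (bigD1 (Ordinal kn))//= ltr_pwDl// sumr_ge0//.
Qed.

Lemma ler_dyadic_mean n f g : (forall k, (k < 2 ^ n)%N -> f k <= g k) ->
  dyadic_mean n f <= dyadic_mean n g.
Proof.
move=> fg; rewrite ler_wpM2l ?invr_ge0 ?exprn_ge0//.
by apply: ler_sum => k _; exact: fg.
Qed.

Lemma eq_dyadic_mean n f g : (forall k, (k < 2 ^ n)%N -> f k = g k) ->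
  dyadic_mean n f = dyadic_mean n g.
Proof.
by move=> fg; congr (_ * _); apply: eq_bigr => k _; exact: fg.
Qed.

Lemma dyadic_meanD n f g :
  dyadic_mean n (fun k => f k + g k) = dyadic_mean n f + dyadic_mean n g.
Proof. by rewrite /dyadic_mean big_split mulrDr. Qed.

Lemma dyadic_meanZ n (c : R) f :
  dyadic_mean n (fun k => c * f k) = c * dyadic_mean n f.
Proof. by rewrite /dyadic_mean -mulr_sumr mulrCA. Qed.

Lemma dyadic_mean_sum n m (F : nat -> nat -> R) :
  dyadic_mean n (fun k => \sum_(i < m) F i k) =
  \sum_(i < m) dyadic_mean n (F i).
Proof. by rewrite /dyadic_mean exchange_big mulr_sumr. Qed.

Lemma dyadic_mean_cst n (c : R) : dyadic_mean n (fun=> c) = c.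
Proof.
rewrite /dyadic_mean sumr_const card_ord -[c *+ _]mulr_natl natrX mulrA.
by rewrite mulVf ?mul1r// expf_neq0// pnatr_eq0.
Qed.

Lemma sum_dyadicS n f :
  \sum_(k < 2 ^ n.+1) f k = \sum_(k < 2 ^ n) (f (2 * k)%N + f (2 * k).+1).
Proof.
rewrite -(big_mkord xpredT f).
rewrite -(big_mkord xpredT (fun k => f (2 * k)%N + f (2 * k).+1)).
rewrite expnS; elim: (2 ^ n)%N => [|m IH]; first by rewrite muln0 !big_geq.
by rewrite mulnS add2n !big_nat_recr//= IH !addrA.
Qed.

Lemma dyadic_meanS n f : dyadic_mean n.+1 f =
  dyadic_mean n (fun k => 2^-1 * (f (2 * k)%N + f (2 * k).+1)).
Proof.
rewrite dyadic_meanZ /dyadic_mean sum_dyadicS exprS invfM.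
by rewrite [2^-1 * (2 ^+ n)^-1]mulrC; ring.
Qed.

Lemma dyadic_mean_half n f :
  dyadic_mean n.+1 (fun k => f (k %/ 2)%N) = dyadic_mean n f.
Proof.
rewrite dyadic_meanS; apply: eq_dyadic_mean => k _ /=.
rewrite mulKn// (_ : (2 * k).+1 %/ 2 = k)%N; last by lia.
by lra.
Qed.

(** The tower property of the dyadic filtration: [k %/ 2 ^ (n - m)] is the
    ancestor of level [m] of the interval [k] of level [n]. *)
Lemma dyadic_mean_ancestor n m f : (m <= n)%N ->
  dyadic_mean n (fun k => f (k %/ 2 ^ (n - m))%N) = dyadic_mean m f.
Proof.
elim: n => [|n IH].
  rewrite leqn0 => /eqP ->; apply: eq_dyadic_mean => k _.
  by rewrite subn0 expn0 divn1.
rewrite leq_eqVlt => /orP[/eqP ->|].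
  by apply: eq_dyadic_mean => k _; rewrite subnn expn0 divn1.
rewrite ltnS => mn; rewrite -[RHS]IH// -[RHS]dyadic_mean_half.
apply: eq_dyadic_mean => k _.
by rewrite subSn// expnS divnMA.
Qed.

End DyadicMean.

(** * Slopes, jumps and Faber--Schauder coefficients *)

Section SlopeMartingale.
Context {R : realType} (x : R -> R).

Definition slope n k : R :=
  2 ^+ n * (x (k.+1%:R / 2 ^+ n) - x (k%:R / 2 ^+ n)).

(** Half the difference of the slopes over the two halves of an interval; up to
    a factor it is the Faber--Schauder coefficient, see [sqr_faber_schauder]. *)
Definition slope_jump n k : R :=
  2 ^+ n * (2 * x ((2 * k + 1)%:R / 2 ^+ n.+1) - x (k%:R / 2 ^+ n)
            - x (k.+1%:R / 2 ^+ n)).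

Lemma dyadic_double n k : (2 * k)%:R / 2 ^+ n.+1 = k%:R / 2 ^+ n :> R.
Proof. by rewrite exprS natrM invfM; field; rewrite expf_neq0// pnatr_eq0. Qed.

Lemma slope_even n k : slope n.+1 (2 * k) = slope n k + slope_jump n k.
Proof.
by rewrite /slope /slope_jump dyadic_double addn1 exprS; ring.
Qed.

Lemma slope_odd n k : slope n.+1 (2 * k).+1 = slope n k - slope_jump n k.
Proof.
have e : (2 * k).+2 = (2 * k.+1)%N by lia.
by rewrite /slope /slope_jump e dyadic_double addn1 exprS; ring.
Qed.

Lemma slope_half n k : `|slope n.+1 k| <=
  `|slope n (k %/ 2)| + `|slope_jump n (k %/ 2)|.
Proof.
have := divn_eq k 2; have := ltn_pmod k (isT : 0 < 2)%N.
case: (k %% 2)%N => [|[|//]] _ {1}->; rewrite mulnC ?addn0 ?addn1.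
  by rewrite slope_even ler_normD.
by rewrite slope_odd ler_normB.
Qed.

Lemma slope_jumpE n k :
  slope_jump n k = 2^-1 * (slope n.+1 (2 * k) - slope n.+1 (2 * k).+1).
Proof. by rewrite slope_even slope_odd; lra. Qed.

Lemma sqr_faber_schauder m k :
  2 ^+ m * faber_schauder x m k ^+ 2 = slope_jump m k ^+ 2.
Proof.
rewrite /faber_schauder /slope_jump !exprMn mulrA; congr (_ * _).
rewrite -[X in _ * X]powR_mulrn ?powR_ge0// -powRrM divfK ?pnatr_eq0//.
by rewrite powR_mulrn ?ler0n// expr2.
Qed.

Definition quadratic_variation n k : R :=
  \sum_(m < n) slope_jump m (k %/ 2 ^ (n.-1 - m)) ^+ 2.

Lemma quadratic_variation_ge0 n k : 0 <= quadratic_variation n k.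
Proof. by rewrite sumr_ge0// => m _; rewrite sqr_ge0. Qed.

Lemma fs_momentE p n :
  fs_moment x p n =
  dyadic_mean n.-1 (fun k => quadratic_variation n k `^ (p / 2)).
Proof.
congr (_ * _); apply: eq_bigr => k _; congr (_ `^ _).
by apply: eq_bigr => m _; rewrite sqr_faber_schauder.
Qed.

(** The squares [slope_jump m k ^+ 2 = 2 ^+ m * faber_schauder x m k ^+ 2] are
    larger than the squared coefficients by the number of intervals of level
    [m], so that the plain sums in [fs_norm] are averages. *)
Lemma fs_norm_sqr n : fs_norm x n ^+ 2 =
  \sum_(m < n) dyadic_mean m (fun k => slope_jump m k ^+ 2).
Proof.
rewrite sqr_sqrtr; last by do 2 (apply: sumr_ge0 => ? _); rewrite sqr_ge0.
apply: eq_bigr => m _; rewrite /dyadic_mean mulr_sumr; apply: eq_bigr => k _.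
by rewrite -sqr_faber_schauder mulKf// expf_neq0// pnatr_eq0.
Qed.

Lemma fs_norm_ge0 n : 0 <= fs_norm x n.
Proof. exact: sqrtr_ge0. Qed.

Definition slope_moment p n : R := dyadic_mean n (fun k => `|slope n k| `^ p).

Lemma slope_momentE p n :
  slope_moment p n = 2 `^ (n%:R * (p - 1)) * pvariation x p n.
Proof.
have n2 : 0 < 2 ^+ n :> R by rewrite exprn_gt0.
rewrite /slope_moment /dyadic_mean /pvariation.
under eq_bigr do rewrite normrM powRM// (gtr0_norm n2).
rewrite -mulr_sumr mulrA; congr (_ * _).
rewrite mulrBr mulr1 powRB ?pnatr_eq0 ?implybT// powR_mulrn// mulrC.
by congr (_ / _); rewrite powRrM powR_mulrn.
Qed.

Lemma slope_le_jumps n k : `|slope n k| <=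
  `|slope 0 (k %/ 2 ^ n)| + \sum_(m < n) `|slope_jump m (k %/ 2 ^ (n - m))|.
Proof.
elim: n k => [|n IH] k; first by rewrite big_ord0 addr0 expn0 divn1.
rewrite (le_trans (slope_half _ _))// big_ord_recr/= subSnn expn1 addrA lerD2r.
rewrite (le_trans (IH _))// -divnMA -expnS lerD2l ler_sum// => m _.
by rewrite -divnMA -expnS subSn// ltnW.
Qed.

(** Bounding every jump by the root of the quadratic variation costs a factor
    [n.+1]; as [quadratic_variation n.+1] lives on level [n], the interval [k]
    of level [n.+1] is sent to its parent. *)
Lemma slope_le_quadratic_variation n k : (k < 2 ^ n.+1)%N ->
  `|slope n.+1 k| <=
  `|slope 0 0| + n.+1%:R * Num.sqrt (quadratic_variation n.+1 (k %/ 2)).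
Proof.
move=> kn; rewrite (le_trans (slope_le_jumps _ _))// divn_small// lerD2l.
apply: ler_sum_ord_cst => m.
rewrite -sqrtr_sqr ler_sqrt ?quadratic_variation_ge0//.
rewrite /quadratic_variation (bigD1 m)//= -divnMA -expnS -subSn; last first.
  by rewrite -ltnS.
by rewrite lerDl sumr_ge0// => i _; rewrite sqr_ge0.
Qed.

End SlopeMartingale.

(** * Comparing the moments of the slopes and of the quadratic variation *)

Section Moments.
Context {R : realType}.
Implicit Types (p : R) (x : R -> R).

Lemma powR_ge1 (a p : R) : 1 <= a -> 0 <= p -> 1 <= a `^ p.
Proof. by move=> a1 p0; have := ler_powR a1 p0; rewrite powRr0. Qed.

(** Because [u + v] is at most twice the larger of [u] and [v]. *)
Lemma powRD_le p (u v : R) : 0 <= p -> 0 <= u -> 0 <= v ->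
  (u + v) `^ p <= 2 `^ p * (u `^ p + v `^ p).
Proof.
move=> p0 u0 v0.
wlog vu : u v u0 v0 / v <= u => [H|].
  by have [/H|/ltW/H] := leP v u; [exact|];
    rewrite addrC [X in _ * X]addrC; exact.
rewrite mulrDr -powRM// (@le_trans _ _ ((2 * u) `^ p))//.
  by rewrite ge0_ler_powR// ?nnegrE ?addr_ge0 ?mulr_ge0//; lra.
by rewrite lerDl mulr_ge0 ?powR_ge0.
Qed.

(** With [S] the sum on the right, each [c i ^+ 2] is at most [S `^ (2 / p)],
    so the sum of squares is at most [n] times that. *)
Lemma sum_sqr_powR_le p n (c : 'I_n -> R) : 0 < p ->
  (\sum_(i < n) c i ^+ 2) `^ (p / 2) <=
  n%:R `^ (p / 2) * \sum_(i < n) `|c i| `^ p.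
Proof.
move=> p0; set S := \sum_(i < n) _ `^ p.
have S0 : 0 <= S by apply: sumr_ge0 => i _; exact: powR_ge0.
have cS i : c i ^+ 2 <= S `^ (2 / p).
  rewrite -[c i ^+ 2]ger0_norm ?sqr_ge0// normrX -powR_mulrn//.
  rewrite -[X in _ `^ X <= _](@mulVKf _ p) ?gt_eqF// [p^-1 * _]mulrC.
  rewrite powRrM ge0_ler_powR// ?nnegrE ?powR_ge0//.
    by rewrite divr_ge0// ltW.
  by rewrite /S (bigD1 i)//= lerDl sumr_ge0// => j _; exact: powR_ge0.
rewrite (@le_trans _ _ ((n%:R * S `^ (2 / p)) `^ (p / 2)))//.
  rewrite ge0_ler_powR ?nnegrE ?divr_ge0 ?(ltW p0) ?mulr_ge0 ?powR_ge0//.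
  - by apply: sumr_ge0 => i _; exact: sqr_ge0.
  - exact: ler_sum_ord_cst.
rewrite powRM ?powR_ge0// -powRrM (_ : 2 / p * (p / 2) = 1) ?powRr1//.
by field; rewrite gt_eqF.
Qed.

Lemma slope_moment_ge0 x p n : 0 <= slope_moment x p n.
Proof. by apply: dyadic_mean_ge0 => k; exact: powR_ge0. Qed.

Lemma fs_moment_ge0 x p n : 0 <= fs_moment x p n.
Proof. by rewrite fs_momentE; apply: dyadic_mean_ge0 => k; exact: powR_ge0. Qed.

(** A weak form of the upper Burkholder inequality, with a power of [n] in
    place of a constant. *)
Lemma slope_moment_le_fs_moment x p n : 0 <= p -> (0 < n)%N ->
  slope_moment x p n <=
  2 `^ p * (`|slope x 0 0| `^ p + n%:R `^ p * fs_moment x p n).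
Proof.
case: n => // n p0 _; rewrite fs_momentE /= -(dyadic_mean_half n).
rewrite -[`|_| `^ p](dyadic_mean_cst n.+1) -!dyadic_meanZ -dyadic_meanD.
rewrite -dyadic_meanZ; apply: ler_dyadic_mean => k kn /=.
have Q0 := quadratic_variation_ge0 x n.+1 (k %/ 2).
have -> : quadratic_variation x n.+1 (k %/ 2) `^ (p / 2) =
    Num.sqrt (quadratic_variation x n.+1 (k %/ 2)) `^ p.
  by rewrite mulrC powRrM powR12_sqrt.
rewrite -powRM ?sqrtr_ge0//.
rewrite (le_trans _ (powRD_le _ _ _)) ?mulr_ge0 ?sqrtr_ge0//.
rewrite ge0_ler_powR ?nnegrE ?addr_ge0 ?mulr_ge0 ?sqrtr_ge0//.
exact: slope_le_quadratic_variation.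
Qed.

Lemma midpoint_powR_le p (u v : R) : 1 <= p ->
  `|2^-1 * (u + v)| `^ p <= 2^-1 * (`|u| `^ p + `|v| `^ p).
Proof.
move=> p1; have p0 : 0 <= p by rewrite (le_trans _ p1).
rewrite (@le_trans _ _ ((2^-1 * `|u| + 2^-1 * `|v|) `^ p))//.
  rewrite ge0_ler_powR ?nnegrE//.
  by rewrite -mulrDr normrM ger0_norm// ler_wpM2l// ler_normD.
rewrite mulrDr {2 4}(_ : 2^-1 = 1 - 2^-1); last by lra.
by apply: (convex_powR p1 (Itv01 _ _)) => //=;
  rewrite ?inE/= ?in_itv/= ?normr_ge0// ?invr_ge0// invf_le1 ?ler1n.
Qed.

(** The convexity inequality for submartingales: each slope is the mean of the
    slopes over the two halves of its interval. *)
Lemma slope_moment_nondecreasing x p : 1 <= p ->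
  {homo slope_moment x p : m n / (m <= n)%N >-> m <= n}.
Proof.
move=> p1; apply: homo_leq => //; first exact: le_trans.
move=> n; rewrite /slope_moment dyadic_meanS; apply: ler_dyadic_mean => k _.
have -> : slope x n k =
    2^-1 * (slope x n.+1 (2 * k) + slope x n.+1 (2 * k).+1).
  by rewrite slope_even slope_odd; lra.
exact: midpoint_powR_le.
Qed.

Lemma jump_moment_le x p m : 1 <= p ->
  dyadic_mean m (fun k => `|slope_jump x m k| `^ p) <=
  slope_moment x p m.+1.
Proof.
move=> p1; rewrite /slope_moment dyadic_meanS; apply: ler_dyadic_mean => k _.
by rewrite slope_jumpE -[`|slope x _ (2 * k).+1|]normrN midpoint_powR_le.
Qed.

(** A weak form of the lower Burkholder inequality: the jumps of every level
    are controlled by the slopes of the next one, whose moments are at most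
    those of the last level. *)
Lemma fs_moment_le_slope_moment x p n : 1 <= p -> (0 < n)%N ->
  fs_moment x p n <= n%:R `^ (p / 2 + 1) * slope_moment x p n.
Proof.
move=> p1 n0; have p0 : 0 < p by rewrite (lt_le_trans _ p1).
rewrite fs_momentE powRD; last by rewrite pnatr_eq0 -lt0n n0 implybT.
rewrite powRr1 ?ler0n// -mulrA.
apply: (@le_trans _ _ (n%:R `^ (p / 2) * \sum_(m < n)
    dyadic_mean m (fun k => `|slope_jump x m k| `^ p))).
  rewrite (_ : \sum_(m < n) _ = dyadic_mean n.-1 (fun k => \sum_(m < n)
      `|slope_jump x m (k %/ 2 ^ (n.-1 - m))| `^ p)).
    rewrite -dyadic_meanZ; apply: ler_dyadic_mean => k _.
    exact: sum_sqr_powR_le.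
  rewrite (dyadic_mean_sum n.-1 n (fun m k =>
    `|slope_jump x m (k %/ 2 ^ (n.-1 - m))| `^ p)).
  apply: eq_bigr => m _.
  rewrite (@dyadic_mean_ancestor _ n.-1 m
    (fun k => `|slope_jump x m k| `^ p))//.
  by rewrite -ltnS prednK.
rewrite ler_wpM2l ?powR_ge0//.
apply: ler_sum_ord_cst => m; rewrite (le_trans (jump_moment_le _ _ _))//.
exact: slope_moment_nondecreasing.
Qed.

Lemma fs_moment_nondecreasing x p n : 0 <= p -> (0 < n)%N ->
  fs_moment x p n <= fs_moment x p n.+1.
Proof.
case: n => // n p0 _; rewrite !fs_momentE /= -(dyadic_mean_half n).
apply: ler_dyadic_mean => k _; rewrite ge0_ler_powR ?nnegrE ?divr_ge0//;
  rewrite ?quadratic_variation_ge0//.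
rewrite /quadratic_variation [leRHS]big_ord_recr/= (@le_trans _ _
  (\sum_(m < n.+1) slope_jump x m (k %/ 2 ^ (n.+1 - m)) ^+ 2))//.
  apply: ler_sum => m _; rewrite -divnMA -expnS -subSn//.
  by rewrite -ltnS.
by rewrite lerDl sqr_ge0.
Qed.

Lemma fs_norm_nondecreasing x :
  {homo fs_norm x : m n / (m <= n)%N >-> m <= n}.
Proof.
apply: homo_leq => //; first exact: le_trans.
move=> n; rewrite /fs_norm big_ord_recr/= ler_wsqrtr// lerDl.
by apply: sumr_ge0 => k _; rewrite sqr_ge0.
Qed.

End Moments.

(** * Sequences negligible against n *)

Section Sublinear.
Context {R : realType}.
Implicit Types u v : nat -> R.

Definition sublinear u := n%:R^-1 * u n @[n --> \oo] --> (0 : R).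

Lemma sublinearP u : sublinear u <->
  forall e : R, 0 < e -> \forall n \near \oo, `|u n| <= e * n%:R.
Proof.
have eqv e n : (0 < n)%N -> (`|n%:R^-1 * u n| <= e) = (`|u n| <= e * n%:R).
  move=> n0; rewrite normrM ger0_norm ?invr_ge0//.
  by rewrite mulrC ler_pdivrMr ?ltr0n.
rewrite /sublinear; split.
  move/cvgr0Pnorm_le => H e e0; near=> n.
  by rewrite -eqv; [near: n; exact: H|near: n; exact: nbhs_infty_gt].
move=> H; apply/cvgr0Pnorm_le => e e0; near=> n.
by rewrite eqv; [near: n; exact: H|near: n; exact: nbhs_infty_gt].
Unshelve. all: by end_near. Qed.

Lemma sublinear_le u v : (\forall n \near \oo, `|u n| <= `|v n|) ->
  sublinear v -> sublinear u.
Proof.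
move=> uv /sublinearP Hv; apply/sublinearP => e e0; near=> n.
by apply: (@le_trans _ _ `|v n|); near: n => //; exact: Hv.
Unshelve. all: by end_near. Qed.

Lemma sublinearD u v : sublinear u -> sublinear v ->
  sublinear (fun n => u n + v n).
Proof.
move=> Hu Hv; rewrite /sublinear; under eq_fun do rewrite mulrDr.
by rewrite -[0]addr0; exact: cvgD.
Qed.

Lemma sublinearZ (c : R) u : sublinear u -> sublinear (fun n => c * u n).
Proof.
move=> Hu; rewrite /sublinear; under eq_fun do rewrite mulrCA.
by rewrite -[0](mulr0 c); exact: cvgMr.
Qed.

Lemma sublinearB u v : sublinear u -> sublinear v ->
  sublinear (fun n => u n - v n).
Proof.
move=> Hu Hv; under eq_fun do rewrite -mulN1r.
by apply: sublinearD => //; exact: sublinearZ.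
Qed.

Lemma near_le_natr (e c : R) : 0 < e -> \forall n \near \oo, c <= e * n%:R.
Proof.
move=> e0; near=> n; rewrite mulrC -ler_pdivrMr//.
by near: n; exact: nbhs_infty_ger.
Unshelve. all: by end_near. Qed.

Lemma sublinear_cst (c : R) : sublinear (fun=> c).
Proof. by apply/sublinearP => e; exact: near_le_natr. Qed.

Lemma sublinear_ln : sublinear (fun n => ln n%:R).
Proof.
apply/sublinearP => e e0; near=> n.
have n1 : 1 <= n%:R :> R by rewrite ler1n; near: n; exact: nbhs_infty_gt.
have n0 : 0 < n%:R :> R by rewrite (lt_le_trans _ n1).
have s0 : 0 < Num.sqrt n%:R :> R by rewrite sqrtr_gt0.
rewrite ger0_norm ?ln_ge0// -{1}[n%:R]sqr_sqrtr ?ler0n// lnXn//.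
rewrite -[_ *+ 2]mulr_natl.
apply: (@le_trans _ _ (2 * Num.sqrt n%:R)).
  by rewrite ler_wpM2l// ltW// ln_sublinear.
have : (2 / e) ^+ 2 <= 1 * n%:R.
  by near: n; exact: near_le_natr.
rewrite mul1r -ler_sqrt ?ler0n// sqrtr_sqr ger0_norm ?divr_ge0 ?(ltW e0)//.
rewrite ler_pdivrMr// => H.
rewrite -[X in e * X]sqr_sqrtr ?ler0n// expr2 mulrA ler_pM2r//.
by rewrite mulrC.
Unshelve. all: by end_near. Qed.

(** Turns a sublinear error into a monotone one, as required of the function
    [rho] in the reverse Jensen inequalities. *)
Lemma sublinear_running_max u : (forall n, 0 <= u n) -> sublinear u ->
  sublinear (fun n => \big[Num.max/0]_(m < n.+1) u m).
Proof.
move=> u0 /sublinearP Hu; apply/sublinearP => e e0.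
have [N _ HN] := Hu _ e0.
near=> n; rewrite ger0_norm; last exact: bigmax_ge_id.
apply/bigmax_leP; split => [|m _]; first by rewrite mulr_ge0// ltW.
have [mN|Nm] := ltnP m N.
  apply: (@le_trans _ _ (\big[Num.max/0]_(i < N) u i)).
    exact: (le_bigmax _ (fun i : 'I_N => u i) (Ordinal mN)).
  by near: n; exact: near_le_natr.
rewrite -[u m]ger0_norm// (le_trans (HN _ Nm))//.
by rewrite ler_wpM2l ?(ltW e0)// ler_nat -ltnS.
Unshelve. all: by end_near. Qed.

Lemma sublinear_ln_comparable u v (C a : R) : 0 < C ->
  (\forall n \near \oo, 0 < u n) -> (\forall n \near \oo, 0 < v n) ->
  (\forall n \near \oo, u n <= C * n%:R `^ a * v n) ->
  (\forall n \near \oo, v n <= C * n%:R `^ a * u n) ->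
  sublinear (fun n => ln (u n) - ln (v n)).
Proof.
move=> C0 u0 v0 uv vu.
apply: (@sublinear_le _ (fun n => ln C + a * ln n%:R)); last first.
  by apply: sublinearD; [exact: sublinear_cst|exact/sublinearZ/sublinear_ln].
have H (s t : R) (n : nat) : (0 < n)%N -> 0 < s -> 0 < t ->
    s <= C * n%:R `^ a * t -> ln s - ln t <= ln C + a * ln n%:R.
  move=> n0 s0 t0; have na : 0 < n%:R `^ a by rewrite powR_gt0// ltr0n.
  rewrite -ler_ln ?posrE ?mulr_gt0// !lnM ?posrE ?mulr_gt0// ln_powR.
  by rewrite lerBlDr.
near=> n; rewrite (le_trans _ (ler_norm _))// ler_norml; apply/andP; split.
  rewrite lerNl opprB; apply: H; near: n => //; exact: nbhs_infty_gt.
by apply: H; near: n => //; exact: nbhs_infty_gt.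
Unshelve. all: by end_near. Qed.

End Sublinear.

(** * The reverse Jensen inequalities as a statement on logarithms *)

Section ReverseJensen.
Context {R : realType}.
Implicit Types (p : R) (x : R -> R).

(** Comparability up to a subexponential factor is sublinearity of the
    difference of logarithms; for the converse, [rho] is the exponential of the
    running maximum of that difference. *)
Lemma subexponential_comparableP (S M : nat -> R) :
  (\forall n \near \oo, 0 < S n) -> (\forall n \near \oo, 0 < M n) ->
  (exists (n0 : nat) (rho : nat -> R),
    [/\ (0 < n0)%N,
        forall n, 1 <= rho n,
        {homo rho : m n / (m <= n)%N >-> m <= n},
        subexponential rho &
        forall n, (n0 <= n)%N ->
          (rho n)^-1 * S n <= M n /\ M n <= rho n * S n]) <->
  sublinear (fun n => ln (M n) - ln (S n)).
Proof.
move=> S0 M0; split=> [[n0 [rho [_ rho1 _ rhos H]]]|Hs].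
  apply: sublinear_le rhos; near=> n.
  have [rhoS rhoM] : (rho n)^-1 * S n <= M n /\ M n <= rho n * S n.
    by apply: H; near: n; exact: nbhs_infty_ge.
  have Sn : 0 < S n by near: n.
  have Mn : 0 < M n by near: n.
  have r0 : 0 < rho n by rewrite (lt_le_trans _ (rho1 n)).
  rewrite [leRHS]ger0_norm ?ln_ge0// ler_norml; apply/andP; split.
    have : ln (S n) <= ln (rho n * M n).
      by rewrite ler_ln ?posrE ?mulr_gt0// -ler_pdivrMl.
    by rewrite lnM ?posrE//; lra.
  by rewrite lerBlDr -lnM ?posrE// ler_ln ?posrE ?mulr_gt0.
pose h n : R := `|ln (M n) - ln (S n)|.
pose H n : R := \big[Num.max/0]_(m < n.+1) h m.
have hH n : h n <= H n by exact: (le_bigmax _ (fun i : 'I_n.+1 => h i) ord_max).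
have [N _ HN] : \forall n \near \oo, 0 < S n /\ 0 < M n.
  by near=> n; split; near: n.
exists N.+1, (fun n => expR (H n)); split => //.
- by move=> n; rewrite -expR0 ler_expR; exact: bigmax_ge_id.
- move=> m n mn; rewrite ler_expR; apply/bigmax_leP; split.
    exact: bigmax_ge_id.
  move=> i _; rewrite -ltnS in mn.
  exact: (le_bigmax _ (fun i : 'I_n.+1 => h i) (widen_ord mn i)).
- have sH : sublinear H.
    apply: sublinear_running_max; first by move=> n; exact: normr_ge0.
    by apply: sublinear_le Hs; near=> n; rewrite normr_id.
  rewrite -/(sublinear (fun n => ln (expR (H n)))).
  apply: sublinear_le sH; near=> n.
  by rewrite expRK.
move=> n Nn; have [Sn Mn] := HN _ (ltnW Nn).
have := hH n; rewrite ler_norml => /andP[H1 H2]; split.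
  rewrite -expRN -[S n]lnK ?posrE// -expRD -[M n]lnK ?posrE// ler_expR.
  by lra.
rewrite -[S n]lnK ?posrE// -expRD -[M n]lnK ?posrE// ler_expR.
by lra.
Unshelve. all: by end_near. Qed.

Lemma fs_moment_gt0 x p m k : 0 < p -> (k < 2 ^ m)%N ->
  slope_jump x m k != 0 -> 0 < fs_moment x p m.+1.
Proof.
move=> p0 km j0; rewrite fs_momentE.
apply: (@dyadic_mean_gt0 _ _ _ k) => // [i|]; first exact: powR_ge0.
rewrite powR_gt0// /quadratic_variation (bigD1 ord_max)//= subnn expn0 divn1.
rewrite ltr_pwDl ?sumr_ge0// => [|i _]; last exact: sqr_ge0.
by rewrite lt0r sqr_ge0 expf_neq0.
Qed.

Lemma fs_norm_gt0 x m k : (k < 2 ^ m)%N -> slope_jump x m k != 0 ->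
  0 < fs_norm x m.+1.
Proof.
move=> km j0; rewrite lt0r fs_norm_ge0 andbT -sqrf_eq0 fs_norm_sqr.
rewrite gt_eqF// big_ord_recr/= ltr_wpDl//.
  by apply: sumr_ge0 => i _; apply: dyadic_mean_ge0 => j; exact: sqr_ge0.
apply: (@dyadic_mean_gt0 _ _ _ k) => // [i|]; first exact: sqr_ge0.
by rewrite lt0r sqr_ge0 expf_neq0.
Qed.

Lemma slope_no_jump x n k :
  (forall m k, (k < 2 ^ m)%N -> slope_jump x m k = 0) ->
  (k < 2 ^ n)%N -> slope x n k = slope x 0 0.
Proof.
move=> j0; elim: n k => [|n IH] k; first by rewrite ltnS leqn0 => /eqP ->.
move=> kn; have k2 : (k %/ 2 < 2 ^ n)%N by rewrite ltn_divLR// mulnC -expnS.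
have := divn_eq k 2; have := ltn_pmod k (isT : 0 < 2)%N.
case: (k %% 2)%N => [|[|//]] _ ->; rewrite mulnC ?addn0 ?addn1.
  by rewrite slope_even j0// addr0 IH.
by rewrite slope_odd j0// subr0 IH.
Qed.

(** The moments of the slopes and of the quadratic variation differ by powers of
    [n], so the latter can be replaced by the former. If there is no jump at
    all, then [fs_norm] and [fs_moment] vanish while [slope_moment] is a
    positive constant, and both sides hold. *)
Lemma reverse_jensen_atP x p : 1 <= p ->
  (exists n k, (k < 2 ^ n)%N /\ slope x n k != 0) ->
  reverse_jensen_at x p <->
  sublinear (fun n => ln (slope_moment x p n) - p * ln (fs_norm x n)).
Proof.
move=> p1 [n1 [k1 [kn1 sl1]]]; have p0 : 0 < p by rewrite (lt_le_trans _ p1).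
have [[m [k [km j0]]]|noj] :=
    pselect (exists m k, (k < 2 ^ m)%N /\ slope_jump x m k != 0); last first.
  have {}noj m k : (k < 2 ^ m)%N -> slope_jump x m k = 0.
    move=> km; apply/eqP; apply: contra_notT noj => j0.
    by exists m, k.
  have s0 n : fs_norm x n = 0.
    apply/eqP; rewrite -sqrf_eq0 fs_norm_sqr big1// => m _.
    rewrite -[RHS](dyadic_mean_cst m); apply: eq_dyadic_mean => k km.
    by rewrite noj// expr0n.
  have M0 n : (0 < n)%N -> fs_moment x p n = 0.
    move=> n0; rewrite fs_momentE -[RHS](dyadic_mean_cst n.-1).
    apply: eq_dyadic_mean => k kn; rewrite /quadratic_variation big1.
      by rewrite powR0// mulf_neq0 ?gt_eqF.
    move=> i _; rewrite noj ?expr0n// ltn_divLR ?expn_gt0// -expnD subnKC//.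
    by rewrite -ltnS prednK.
  split=> _; last first.
    exists 1%N, (fun=> 1); split => //.
      by rewrite /subexponential ln1; exact: sublinear_cst.
    by move=> n n0; rewrite s0 M0// powR0 ?mulr0 ?gt_eqF.
  under eq_fun => n.
    rewrite s0 (ln0 (lexx 0)) mulr0 subr0 /slope_moment.
    rewrite (@eq_dyadic_mean _ n _ (fun=> `|slope x 0 0| `^ p)).
      rewrite dyadic_mean_cst; over.
    by move=> k kn; rewrite slope_no_jump.
  exact: sublinear_cst.
have sn0 : \forall n \near \oo, 0 < fs_norm x n.
  exists m.+1 => // n /= mn.
  by rewrite (lt_le_trans (fs_norm_gt0 km j0))// fs_norm_nondecreasing.
have Mmu n : (m < n)%N -> fs_moment x p m.+1 <= fs_moment x p n.
  elim: n => // n IH; rewrite ltnS leq_eqVlt => /orP[/eqP ->//|mn].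
  rewrite (le_trans (IH mn))// fs_moment_nondecreasing// ?ltW//.
  by rewrite (leq_ltn_trans _ mn).
have mu0 := fs_moment_gt0 p0 km j0; set mu := fs_moment x p m.+1 in mu0 Mmu.
have M0 : \forall n \near \oo, 0 < fs_moment x p n.
  by exists m.+1 => // n /= mn; rewrite (lt_le_trans mu0)// Mmu.
have A0 : \forall n \near \oo, 0 < slope_moment x p n.
  exists m.+1 => // n /= mn.
  have n0 : (0 < n)%N by rewrite (leq_ltn_trans _ mn).
  have := lt_le_trans mu0 (Mmu _ mn) => /lt_le_trans.
  move=> /(_ _ (fs_moment_le_slope_moment _ p1 n0)).
  by rewrite pmulr_rgt0// powR_gt0// ltr0n.
(* The term coming from [slope x 0 0] is absorbed with the help of [mu], a
   positive lower bound of [fs_moment x p n] for large [n]. *)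
pose C := 2 `^ p * (`|slope x 0 0| `^ p / mu + 1).
have C1 : 1 <= C.
  rewrite -[1]mulr1 ler_pM// ?lerDr ?divr_ge0 ?powR_ge0 ?(ltW mu0)//.
  by rewrite powR_ge1 ?ler1n// ltW.
have AM : sublinear (fun n => ln (slope_moment x p n) - ln (fs_moment x p n)).
  apply: (@sublinear_ln_comparable _ _ _ C (p + 1)) => //.
  - by rewrite (lt_le_trans _ C1).
  - exists m.+1 => // n /= mn.
    have n0 : (0 < n)%N by rewrite (leq_ltn_trans _ mn).
    have n1' : 1 <= n%:R :> R by rewrite ler1n.
    rewrite (le_trans (slope_moment_le_fs_moment _ (ltW p0) n0))//.
    rewrite /C -!mulrA ler_wpM2l ?powR_ge0// mulrDl mul1r lerD//.
      rewrite -mulrA ler_peMr ?powR_ge0// ler_pdivlMl// mulr1.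
      rewrite (le_trans (Mmu _ mn))// ler_peMl ?fs_moment_ge0//.
      by rewrite powR_ge1// addr_ge0 ?(ltW p0).
    by rewrite ler_wpM2r ?fs_moment_ge0// ler_powR// lerDl.
  - exists m.+1 => // n /= mn.
    have n0 : (0 < n)%N by rewrite (leq_ltn_trans _ mn).
    have n1' : 1 <= n%:R :> R by rewrite ler1n.
    rewrite (le_trans (fs_moment_le_slope_moment _ p1 n0))//.
    rewrite ler_wpM2r ?slope_moment_ge0////.
    apply: (@le_trans _ _ (n%:R `^ (p + 1))).
      by rewrite ler_powR// lerD2r; lra.
    by rewrite ler_peMl ?powR_ge0.
rewrite /reverse_jensen_at.
have -> : (fun n => ln (slope_moment x p n) - p * ln (fs_norm x n)) =
  (fun n => (ln (slope_moment x p n) - ln (fs_moment x p n)) +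
            (ln (fs_moment x p n) - ln (fs_norm x n `^ p))).
  by apply/funext => n; rewrite ln_powR; lra.
have spos : \forall n \near \oo, 0 < fs_norm x n `^ p.
  by near=> n; rewrite powR_gt0//; near: n.
split=> [/(subexponential_comparableP spos M0)|H]; first exact: sublinearD.
apply/(subexponential_comparableP spos M0).
have := sublinearB H AM; congr sublinear; apply/funext => n; lra.
Unshelve. all: by end_near. Qed.
End ReverseJensen.

(** * Consequences of continuity on the unit interval *)

Section ContinuousFunctions.
Context {R : realType} (x : R -> R).
Context (x_continuous : {within `[0, 1], continuous x}).

Lemma near_expVn_le (d : R) : 0 < d -> \forall n \near \oo, (2 ^+ n)^-1 <= d.
Proof.
move=> d0; near=> n; rewrite -[leRHS]invrK.
rewrite lef_pV2 ?posrE ?invr_gt0 ?exprn_gt0//.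
apply: (@le_trans _ _ n%:R); first by near: n; exact: nbhs_infty_ger.
by rewrite -natrX ler_nat ltnW// ltn_expl.
Unshelve. all: by end_near. Qed.

Lemma dyadic_unif_continuous (e : R) : 0 < e -> \forall n \near \oo,
  forall u v, u \in `[0, 1] -> v \in `[0, 1] -> `|u - v| <= (2 ^+ n)^-1 ->
  `|x u - x v| <= e.
Proof.
move=> e0.
pose P (n : nat) (u : R) := u \in `[0, 1] -> forall v, v \in `[0, 1] ->
  `|u - v| <= (2 ^+ n)^-1 -> `|x u - x v| <= e.
have /(iffLR (compact_near_coveringP _))/(_ _ \oo P) := @segment_compact R 0 1.
suff H : forall t, (`[0, 1]%classic : set R) t ->
    \forall u \near t & i \near \oo, P i u.
  move=> /(_ _ H); apply: filterS => n Hn u v u01 v01; exact: Hn.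
move=> t t01; have e2 : 0 < e / 2 by lra.
have /subspace_continuousP/(_ t t01)/cvgr_dist_lt/(_ _ e2) := x_continuous.
rewrite /= near_withinE => /nbhs_ballP[d /= d0 Hd].
exists (ball t (d / 2), [set n | (2 ^+ n)^-1 <= d / 4]) => /=.
  split; first by apply: nbhsx_ballx; lra.
  by apply: near_expVn_le; lra.
move=> [u n] [/= tu nd] u01 v v01 uv.
have Hu : `|x t - x u| < e / 2.
  by apply: Hd => //; apply: le_ball tu; lra.
have Hv : `|x t - x v| < e / 2.
  apply: Hd => //; rewrite /ball/=; rewrite /ball/= in tu.
  rewrite (_ : t - v = (t - u) + (u - v)); last by lra.
  by rewrite (le_lt_trans (ler_normD _ _))//; lra.
rewrite (_ : x u - x v = (x t - x v) - (x t - x u)); last by lra.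
by rewrite (le_trans (ler_normB _ _))//; lra.
Unshelve. all: by end_near. Qed.

Lemma dyadic_point_in_unit n k : (k <= 2 ^ n)%N ->
  (k%:R / 2 ^+ n : R) \in `[0, 1].
Proof.
move=> kn; rewrite in_itv/= divr_ge0//= ler_pdivrMr ?exprn_gt0// mul1r.
by rewrite -natrX ler_nat.
Qed.

Lemma bounded_on_unit : exists2 C, 1 <= C &
  forall t, t \in `[0, 1] -> `|x t| <= C.
Proof.
have [a _ Ha] := EVT_max (@ler01 R) x_continuous.
have [b _ Hb] := EVT_min (@ler01 R) x_continuous.
exists (1 + `|x a| + `|x b|); first by rewrite -addrA lerDl addr_ge0.
move=> t t01; rewrite ler_norml; apply/andP; split.
  by rewrite (le_trans _ (Hb _ t01))// (le_trans _ (lerNnormlW (lexx _)))//;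
     have := normr_ge0 (x a); lra.
rewrite (le_trans (Ha _ t01))//.
by have := ler_norm (x a); have := normr_ge0 (x b); lra.
Qed.

(** If all dyadic increments vanished, [x] would be constant by density. *)
Lemma exists_slope_neq0 :
  (exists s t : R, [/\ s \in `[0, 1], t \in `[0, 1] & x s != x t]) ->
  exists n k, (k < 2 ^ n)%N /\ slope x n k != 0.
Proof.
move=> [s [t [s01 t01 st]]]; apply: contrapT => H.
have {}H n k : (k < 2 ^ n)%N -> x (k.+1%:R / 2 ^+ n) = x (k%:R / 2 ^+ n).
  move=> kn; apply: contrapT => /eqP neq; apply: H; exists n, k; split => //.
  by rewrite mulf_neq0 ?subr_eq0// expf_neq0// pnatr_eq0.
have {}H n k : (k <= 2 ^ n)%N -> x (k%:R / 2 ^+ n) = x 0.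
  by elim: k => [|k IH] kn; [rewrite mul0r|rewrite H// IH// ltnW].
suff x0 u : u \in `[0, 1] -> x u = x 0 by move: st; rewrite !x0// eqxx.
move=> u01; apply/eqP; rewrite -subr_eq0 -normr_le0; apply/ler_addgt0Pl => e e0.
rewrite addr0; have [N _ /(_ N (leqnn N)) HN] := dyadic_unif_continuous e0.
have n2 : 0 < 2 ^+ N :> R by rewrite exprn_gt0.
have [u0 u1] : 0 <= u /\ u <= 1 by move: u01; rewrite in_itv/= => /andP.
pose k := Num.truncn (u * 2 ^+ N).
have /andP[ku uk] : k%:R <= u * 2 ^+ N < k.+1%:R.
  by rewrite truncn_itv// mulr_ge0 ?(ltW n2).
have kN : (k <= 2 ^ N)%N.
  rewrite -(ler_nat R) (le_trans ku)// natrX ler_piMl// ltW//.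
rewrite -(H N k)//; apply: HN => //; first exact: dyadic_point_in_unit.
rewrite ger0_norm ?subr_ge0 ?ler_pdivrMr//.
rewrite lerBlDr -[X in X + _]div1r -mulrDl ler_pdivlMr//.
by rewrite addrC natr1 ltW.
Qed.

Lemma increment_unif_small (e : R) : 0 < e -> \forall n \near \oo,
  forall k, (k < 2 ^ n)%N ->
  `|x (k.+1%:R / 2 ^+ n) - x (k%:R / 2 ^+ n)| <= e.
Proof.
move=> e0; apply: filterS (dyadic_unif_continuous e0) => n Hn k kn.
apply: Hn; [exact: dyadic_point_in_unit|exact/dyadic_point_in_unit/ltnW|].
by rewrite -mulrBl -natr1 addrAC subrr add0r mul1r ger0_norm.
Qed.

Lemma fs_norm_le_expn : exists2 C, 1 <= C & forall n, fs_norm x n <= C * 2 ^+ n.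
Proof.
have [C C1 HC] := bounded_on_unit.
have C0 : 0 <= C by lra.
exists (4 * C); first by lra.
move=> n; have n0 : 0 <= 4 * C * 2 ^+ n by rewrite !mulr_ge0 ?exprn_ge0.
rewrite -(@ler_pXn2r _ 2)// ?nnegrE ?fs_norm_ge0//.
rewrite fs_norm_sqr exprMn.
have e4 m : (2 ^+ m) ^+ 2 = 4 ^+ m :> R.
  by rewrite expr2 -exprMn; congr (_ ^+ _); lra.
have jb m k : (k < 2 ^ m)%N -> slope_jump x m k ^+ 2 <= (4 * C) ^+ 2 * 4 ^+ m.
  move=> km; rewrite /slope_jump exprMn mulrC e4.
  rewrite ler_wpM2r ?exprn_ge0// -[leLHS]ger0_norm ?sqr_ge0// normrX.
  rewrite lerXn2r ?nnegrE//; first by rewrite mulr_ge0.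
  have h1 : `|x ((2 * k + 1)%:R / 2 ^+ m.+1)| <= C.
    by apply/HC/dyadic_point_in_unit; rewrite expnS; lia.
  have h2 : `|x (k%:R / 2 ^+ m)| <= C.
    by apply/HC/dyadic_point_in_unit/ltnW.
  have h3 : `|x (k.+1%:R / 2 ^+ m)| <= C by apply/HC/dyadic_point_in_unit.
  move: h1 h2 h3; rewrite !ler_norml => /andP[? ?] /andP[? ?] /andP[? ?].
  by apply/andP; split; lra.
apply: (@le_trans _ _ (\sum_(m < n) (4 * C) ^+ 2 * 4 ^+ m)).
  apply: ler_sum => m _; rewrite -[leRHS](dyadic_mean_cst m).
  by apply: ler_dyadic_mean => k km; exact: jb.
rewrite -mulr_sumr ler_wpM2l ?sqr_ge0// e4.
elim: n {n0} => [|n IH]; first by rewrite big_ord0 expr0 ler01.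
have p4 : 0 <= 4 ^+ n :> R by exact: exprn_ge0.
by rewrite big_ord_recr/= exprS; lra.
Qed.

End ContinuousFunctions.

(** * The p-th variation and the roughness estimate *)

Section ExponentialRates.
Context {R : realType}.
Implicit Types (v : nat -> R) (c : R).

Lemma cvg0_of_rate v c : (forall n, 0 <= v n) -> c < 0 ->
  sublinear (fun n => ln (v n) - n%:R * c) -> v n @[n --> \oo] --> (0 : R).
Proof.
move=> v0 c0 /sublinearP H; apply/cvgr0Pnorm_le => e e0.
have c2 : 0 < - c / 2 by lra.
near=> n; rewrite ger0_norm//.
have [->|vn0] := eqVneq (v n) 0; first exact: ltW.
have vn : 0 < v n by rewrite lt0r vn0 v0.
rewrite -ler_ln ?posrE//.
have : `|ln (v n) - n%:R * c| <= - c / 2 * n%:R by near: n; exact: H.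
have : - ln e <= - c / 2 * n%:R by near: n; exact: near_le_natr.
rewrite ler_norml => h1 /andP[_ h2].
by lra.
Unshelve. all: by end_near. Qed.

Lemma cvgy_of_rate v c : 0 < c ->
  sublinear (fun n => ln (v n) - n%:R * c) -> v n @[n --> \oo] --> +oo.
Proof.
move=> c0 /sublinearP H; apply/cvgryPge => A.
have c2 : 0 < c / 2 by lra.
near=> n.
have h1 : `|ln (v n) - n%:R * c| <= c / 2 * n%:R by near: n; exact: H.
have h2 : ln (Num.max A 1) <= c / 2 * n%:R by near: n; exact: near_le_natr.
have h3 : 1 <= c / 2 * n%:R by near: n; exact: near_le_natr.
have A1 : 0 < Num.max A 1 by rewrite lt_max ltr01 orbT.
have {}h1 : c / 2 * n%:R <= ln (v n).
  by move: h1; rewrite ler_norml => /andP[h1 _]; lra.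
have vn : 0 < v n.
  by rewrite ltNge; apply/negP => /ln0 v0; rewrite v0 in h1; lra.
apply: (@le_trans _ _ (Num.max A 1)); first by rewrite le_max lexx.
by rewrite -ler_ln ?posrE// (le_trans h2).
Unshelve. all: by end_near. Qed.

End ExponentialRates.

Section Roughness.
Context {R : realType}.
Implicit Types (x : R -> R) (p q r e : R).

(** Writing [1 < p * r] and [p * r < 1] for [q < p] and [p < q] treats
    [q = +oo], that is [r = 0], together with the finite exponents. *)
Lemma admits_roughness_exponentP x r : admits_roughness_exponent x r <->
  [/\ 0 <= r <= 1,
      forall p, 0 < p -> 1 < p * r ->
        pvariation x p n @[n --> \oo] --> (0 : R) &
      forall p, 0 < p -> p * r < 1 -> pvariation x p n @[n --> \oo] --> +oo].
Proof.
split=> [[[q| |] [q1 rq V0 Vy]]|[/andP[r0 r1] V0 Vy]].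
- rewrite lee_fin in q1; have q0 : 0 < q by rewrite (lt_le_trans _ q1).
  have {}rq : r = q^-1 by move: rq; rewrite inver gt_eqF// => -[].
  split=> [|p p0|p p0]; rewrite {}rq.
  + by rewrite invr_ge0 (ltW q0) invf_le1.
  + by rewrite ltr_pdivlMr// mul1r => qp; apply: V0; rewrite ?lte_fin.
  + by rewrite ltr_pdivrMr// mul1r => pq; apply: Vy; rewrite ?lte_fin.
- have {}rq : r = 0 by move: rq; rewrite invey => -[].
  split=> [|p p0|p p0 _]; rewrite ?rq ?lexx ?ler01 ?mulr0 ?ltr10//.
  + by apply: Vy => //; exact: ltry.
- by move: q1; rewrite leeNy_eq.
have [rE|rneq0] := eqVneq r 0.
  exists +oo%E; split=> [||p _|p p0 _]; [exact: leey|by rewrite rE| |].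
    by rewrite ltNge leey.
  by apply: Vy; rewrite ?rE ?mulr0.
have {}r0 : 0 < r by rewrite lt0r rneq0.
exists (r^-1)%:E; split => [||p p0|p p0].
- by rewrite lee_fin invf_ge1.
- by rewrite inver invr_eq0 gt_eqF// invrK.
- by rewrite lte_fin => h; apply: V0 => //; rewrite -ltr_pdivrMr// div1r.
- by rewrite lte_fin => h; apply: Vy => //; rewrite -ltr_pdivlMr// div1r.
Qed.

Lemma pvariation_ge0 x p n : 0 <= pvariation x p n.
Proof. by apply: sumr_ge0 => k _; exact: powR_ge0. Qed.

Lemma slope_moment_gt0 x p n k : 0 < p -> (k < 2 ^ n)%N -> slope x n k != 0 ->
  0 < slope_moment x p n.
Proof.
move=> p0 kn sn; apply: (@dyadic_mean_gt0 _ _ _ k) => //.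
by rewrite powR_gt0// normr_gt0.
Qed.

Lemma near_pvariation_gt0 x p : 1 <= p ->
  (exists n k, (k < 2 ^ n)%N /\ slope x n k != 0) ->
  \forall n \near \oo, 0 < pvariation x p n.
Proof.
move=> p1 [N [k [kN sl]]]; have p0 : 0 < p by rewrite (lt_le_trans _ p1).
exists N => // n /= Nn.
have := lt_le_trans (slope_moment_gt0 p0 kN sl)
                    (slope_moment_nondecreasing x p1 Nn).
by rewrite slope_momentE pmulr_rgt0// powR_gt0.
Qed.

(** The bridge between the two notions: under the reverse Jensen inequalities
    the [p]-th variation is [2 `^ (n%:R * (1 - p * roughness_estimate x n))] up
    to a subexponential factor. *)
Lemma reverse_jensen_atP_pvariation x p : 1 <= p ->
  (exists n k, (k < 2 ^ n)%N /\ slope x n k != 0) ->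
  reverse_jensen_at x p <->
  sublinear (fun n => ln (pvariation x p n) -
                      n%:R * (ln 2 * (1 - p * roughness_estimate x n))).
Proof.
move=> p1 nc; rewrite reverse_jensen_atP//.
have ln2 : ln 2 != 0 :> R by rewrite gt_eqF// ln_gt0// ltr1n.
have e : \forall n \near \oo,
    ln (slope_moment x p n) - p * ln (fs_norm x n) =
    ln (pvariation x p n) -
      n%:R * (ln 2 * (1 - p * roughness_estimate x n)).
  near=> n.
  have n0 : n%:R != 0 :> R.
    by rewrite pnatr_eq0 -lt0n; near: n; exact: nbhs_infty_gt.
  have V0 : 0 < pvariation x p n by near: n; exact: near_pvariation_gt0.
  rewrite slope_momentE lnM ?posrE ?powR_gt0// ln_powR /roughness_estimate.
  by field; rewrite n0 ln2.
split; apply: sublinear_le; near=> n.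
  by rewrite -(near e n).
by rewrite (near e n).
Unshelve. all: by end_near. Qed.

Lemma roughness_estimate_ge x p e : 0 < p -> 0 < e ->
  sublinear (fun n => ln (pvariation x p n) -
                      n%:R * (ln 2 * (1 - p * roughness_estimate x n))) ->
  (\forall n \near \oo, pvariation x p n <= 1) ->
  \forall n \near \oo, p^-1 - e <= roughness_estimate x n.
Proof.
move=> p0 e0 /sublinearP H V1.
have l2 : 0 < ln 2 :> R by rewrite ln_gt0// ltr1n.
have d0 : 0 < ln 2 * (p * e) by rewrite !mulr_gt0.
near=> n; have n0 : 0 < n%:R :> R.
  by rewrite ltr0n; near: n; exact: nbhs_infty_gt.
have : `|ln (pvariation x p n) -
         n%:R * (ln 2 * (1 - p * roughness_estimate x n))|
    <= ln 2 * (p * e) * n%:R by near: n; exact: H.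
have lV : ln (pvariation x p n) <= 0 by apply: ln_le0; near: n.
rewrite ler_norml => /andP[h _].
have : n%:R * (ln 2 * (1 - p * roughness_estimate x n)) <=
       n%:R * (ln 2 * (p * e)).
  by rewrite [leRHS]mulrC; lra.
rewrite !ler_pM2l// => h2.
by rewrite -(ler_pM2l p0) [leLHS]mulrBr divff ?gt_eqF//; lra.
Unshelve. all: by end_near. Qed.

Lemma roughness_estimate_le x p e : 0 < p -> 0 < e ->
  sublinear (fun n => ln (pvariation x p n) -
                      n%:R * (ln 2 * (1 - p * roughness_estimate x n))) ->
  (\forall n \near \oo, 1 <= pvariation x p n) ->
  \forall n \near \oo, roughness_estimate x n <= p^-1 + e.
Proof.
move=> p0 e0 /sublinearP H V1.
have l2 : 0 < ln 2 :> R by rewrite ln_gt0// ltr1n.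
have d0 : 0 < ln 2 * (p * e) by rewrite !mulr_gt0.
near=> n; have n0 : 0 < n%:R :> R.
  by rewrite ltr0n; near: n; exact: nbhs_infty_gt.
have : `|ln (pvariation x p n) -
         n%:R * (ln 2 * (1 - p * roughness_estimate x n))|
    <= ln 2 * (p * e) * n%:R by near: n; exact: H.
have lV : 0 <= ln (pvariation x p n) by apply: ln_ge0; near: n.
rewrite ler_norml => /andP[_ h].
have : n%:R * (ln 2 * (p * roughness_estimate x n - 1)) <=
       n%:R * (ln 2 * (p * e)).
  by rewrite [leRHS]mulrC; lra.
rewrite !ler_pM2l// => h2.
by rewrite -(ler_pM2l p0) [leRHS]mulrDr divff ?gt_eqF//; lra.
Unshelve. all: by end_near. Qed.

(** [fs_norm] is nondecreasing, so the logarithm of [fs_norm] is bounded below;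
    if [fs_norm] vanishes identically this rests on [ln 0 = 0]. *)
Lemma near_roughness_estimate_le1 x e : 0 < e ->
  \forall n \near \oo, roughness_estimate x n <= 1 + e.
Proof.
move=> e0; have l2 : 0 < ln 2 :> R by rewrite ln_gt0// ltr1n.
have [K HK] : exists K, \forall n \near \oo, K <= ln (fs_norm x n).
  have [[N sN]|s0] := pselect (exists N, 0 < fs_norm x N).
    exists (ln (fs_norm x N)), N => // n /= Nn.
    have ss := fs_norm_nondecreasing x Nn.
    by rewrite ler_ln ?posrE// (lt_le_trans sN).
  exists 0, 0%N => // n _; rewrite ln0// leNgt; apply/negP => sn.
  by apply: s0; exists n.
near=> n; have n0 : 0 < n%:R :> R.
  by rewrite ltr0n; near: n; exact: nbhs_infty_gt.
rewrite /roughness_estimate lerD2l -mulrN mulrC ler_pdivrMr//.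
rewrite -mulNr ler_pdivrMr// mulrAC.
have h1 : - K <= e * ln 2 * n%:R.
  by near: n; apply: near_le_natr; exact: mulr_gt0.
have : K <= ln (fs_norm x n) by near: n.
by lra.
Unshelve. all: by end_near. Qed.

(** A bounded [x] has [fs_norm] of order at most [2 ^+ n]. *)
Lemma near_roughness_estimate_ge0 x e : {within `[0, 1], continuous x} ->
  0 < e -> \forall n \near \oo, - e <= roughness_estimate x n.
Proof.
move=> xc e0; have l2 : 0 < ln 2 :> R by rewrite ln_gt0// ltr1n.
have [C C1 HC] := fs_norm_le_expn xc.
near=> n; have n0 : 0 < n%:R :> R.
  by rewrite ltr0n; near: n; exact: nbhs_infty_gt.
have h1 : ln C <= e * ln 2 * n%:R.
  by near: n; apply: near_le_natr; exact: mulr_gt0.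
have h2 : ln (fs_norm x n) <= ln C + n%:R * ln 2.
  have [s0|s0] := ltP 0 (fs_norm x n).
    have C0 : 0 < C by lra.
    rewrite mulr_natl -lnXn// -lnM ?posrE ?exprn_gt0//.
    by rewrite ler_ln ?posrE ?mulr_gt0 ?exprn_gt0.
  by rewrite ln0// addr_ge0 ?ln_ge0// mulr_ge0// ltW.
have h3 : n%:R^-1 * (ln (fs_norm x n) / ln 2) <= 1 + e.
  by rewrite mulrC ler_pdivrMr// ler_pdivrMr//; lra.
by rewrite /roughness_estimate; lra.
Unshelve. all: by end_near. Qed.
End Roughness.

(** * Variations near the critical exponent *)

Section CriticalExponent.
Context {R : realType}.
Implicit Types (x : R -> R) (p q r e : R).

(** Increments of size at most [t = 2^(-n/p)] contribute at most 1 to the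
    [p]-th variation, because there are [2 ^ n] of them; for a larger increment
    [y] one has [y `^ p <= y `^ q * t `^ (p - q)]. *)
Lemma pvariation_interpolation x p q n : 0 < p -> p < q ->
  pvariation x p n <=
  1 + pvariation x q n * expR (n%:R * ln 2 * ((q - p) / p)).
Proof.
move=> p0 pq; set E := expR _.
have key (y : R) : 0 <= y -> y `^ p <= (2 ^+ n)^-1 + y `^ q * E.
  move=> y0; pose t := expR (- (n%:R * ln 2 / p)).
  have tp : t `^ p = (2 ^+ n)^-1.
    rewrite /t -expRM mulNr divfK ?gt_eqF// expRN mulrC expRM.
    by rewrite lnK ?posrE// powR_mulrn.
  have [yt|ty] := leP y t.
    apply: (@le_trans _ _ (2 ^+ n)^-1); last first.
      by rewrite lerDl mulr_ge0 ?powR_ge0 ?expR_ge0.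
    by rewrite -tp ge0_ler_powR// ?nnegrE ?ltW ?expR_gt0.
  apply: (@le_trans _ _ (y `^ q * E)); last first.
    by rewrite lerDr invr_ge0 exprn_ge0.
  have y0' : 0 < y by rewrite (lt_trans _ ty)// expR_gt0.
  rewrite /powR gt_eqF// -expRD ler_expR.
  have : - (n%:R * ln 2 / p) < ln y.
    by rewrite -[ltLHS]expRK ltr_ln ?posrE ?expR_gt0.
  have qp : 0 < q - p by rewrite subr_gt0.
  rewrite -(ltr_pM2l qp) => h.
  have : (q - p) * - (n%:R * ln 2 / p) = - (n%:R * ln 2 * ((q - p) / p)).
    by ring.
  by move=> h'; rewrite h' in h; lra.
rewrite /pvariation mulr_suml.
apply: (@le_trans _ _ (\sum_(k < 2 ^ n) ((2 ^+ n)^-1 +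
  `|x (k.+1%:R / 2 ^+ n) - x (k%:R / 2 ^+ n)| `^ q * E))).
  by apply: ler_sum => k _; exact: key.
rewrite big_split/= lerD2r sumr_const card_ord -[leLHS]mulr_natl natrX.
by rewrite divff// expf_neq0// pnatr_eq0.
Qed.

(** Interpolating the exponent [q] with a slightly larger one bounds the [q]-th
    variation from above; interpolating a slightly smaller one with [q] bounds
    it from below. *)
Lemma pvariation_critical_sublinear x q : 0 < q ->
  (\forall n \near \oo, 0 < pvariation x q n) ->
  (forall p, 0 < p -> q < p -> pvariation x p n @[n --> \oo] --> (0 : R)) ->
  (forall p, 0 < p -> p < q -> pvariation x p n @[n --> \oo] --> +oo) ->
  sublinear (fun n => ln (pvariation x q n)).
Proof.
move=> q0 Vq0 V0 Vy; apply/sublinearP => e e0.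
have l2 : 0 < ln 2 :> R by rewrite ln_gt0// ltr1n.
(* Chosen so that [ln 2 * ((p1 - q) / q) = e / 2]; the other half of [e] pays
   for the constant [ln 2]. *)
pose p1 := q * (1 + e / 2 / ln 2).
have qp1 : q < p1 by rewrite ltr_pMr// ltrDl !divr_gt0.
have p10 : 0 < p1 by rewrite (lt_trans q0).
have e1 : ln 2 * ((p1 - q) / q) = e / 2 by rewrite /p1; field; rewrite !gt_eqF.
(* Chosen so that [ln 2 * ((q - p2) / p2) = e]. *)
pose p2 := q / (1 + e / ln 2).
have el : 0 < e / ln 2 by rewrite divr_gt0.
have p2q : p2 < q by rewrite ltr_pdivrMr ?ltr_pMr// ?ltrDl//; lra.
have p20 : 0 < p2 by rewrite divr_gt0//; lra.
have e2 : ln 2 * ((q - p2) / p2) = e.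
  by rewrite /p2; field; rewrite !gt_eqF//; lra.
near=> n.
have Vn : 0 < pvariation x q n by near: n.
rewrite ler_norml; apply/andP; split.
  have : 2 <= pvariation x p2 n.
    by near: n; exact: (iffLR (cvgryPge _) (Vy _ p20 p2q)).
  move=> /le_trans/(_ (pvariation_interpolation x n p20 p2q)).
  rewrite -mulrA e2 => h.
  have {}h : expR (- (n%:R * e)) <= pvariation x q n.
    rewrite expRN -[leLHS]div1r ler_pdivrMr ?expR_gt0//; lra.
  by rewrite -[leLHS]expRK ler_ln ?posrE ?expR_gt0// [e * _]mulrC.
have h1 : pvariation x p1 n <= 1.
  by near: n; exact: (cvgr_le _ (V0 _ p10 qp1) _ ltr01).
have h2 : ln 2 <= e / 2 * n%:R by near: n; apply: near_le_natr; lra.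
have := pvariation_interpolation x n q0 qp1; rewrite -mulrA e1 => h.
have E1 : 1 <= expR (n%:R * (e / 2)).
  by rewrite -expR0 ler_expR mulr_ge0 ?divr_ge0 ?(ltW e0).
have {}h : pvariation x q n <= 2 * expR (n%:R * (e / 2)).
  apply: (le_trans h); rewrite [leRHS]mulrDl mul1r lerD//.
  by rewrite ler_piMl ?expR_ge0.
have : ln (pvariation x q n) <= ln 2 + n%:R * (e / 2).
  rewrite -[X in _ + X]expRK -lnM ?posrE ?expR_gt0//.
  by rewrite ler_ln ?posrE ?mulr_gt0 ?expR_gt0.
by lra.
Unshelve. all: by end_near. Qed.

(** The first variation is bounded away from 0, and an increment [y <= e]
    satisfies [y `^ p >= y * e `^ (p - 1)], where [e `^ (p - 1)] is as large as
    desired for small [e]. *)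
Lemma pvariation_lt1_cvgy x p : {within `[0, 1], continuous x} ->
  (exists n k, (k < 2 ^ n)%N /\ slope x n k != 0) ->
  0 < p -> p < 1 -> pvariation x p n @[n --> \oo] --> +oo.
Proof.
move=> xc [N [k [kN sl]]] p0 p1; apply/cvgryPge => A.
have c0 := slope_moment_gt0 ltr01 kN sl; set c := slope_moment x 1 N in c0.
have B0 : 0 < Num.max A 1 by rewrite lt_max ltr01 orbT.
have AB : A <= Num.max A 1 by rewrite le_max lexx.
set B := Num.max A 1 in B0 AB.
(* The size of increments for which [c * e `^ (p - 1) = B]. *)
pose e := (B / c) `^ ((p - 1)^-1).
have e0 : 0 < e by rewrite powR_gt0 ?divr_gt0.
have eE : e `^ (p - 1) = B / c.
  by rewrite -powRrM mulVf ?powRr1 ?divr_ge0 ?ltW// subr_eq0 lt_eqF.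
near=> n; apply: (le_trans AB).
have -> : B = c * e `^ (p - 1) by rewrite eE; field; rewrite gt_eqF.
have : c <= slope_moment x 1 n.
  by apply: slope_moment_nondecreasing => //; near: n; exact: nbhs_infty_ge.
rewrite slope_momentE subrr mulr0 powRr0 mul1r => cV.
apply: (@le_trans _ _ (pvariation x 1 n * e `^ (p - 1))).
  by rewrite ler_wpM2r ?powR_ge0.
rewrite /pvariation mulr_suml; apply: ler_sum => i _.
have ye : `|x (i.+1%:R / 2 ^+ n) - x (i%:R / 2 ^+ n)| <= e.
  have := ltn_ord i; move: (nat_of_ord i); near: n.
  by apply: filterS (increment_unif_small xc e0) => n.
move: ye; set y : R := `|_|; move=> ye; rewrite powRr1 ?normr_ge0//.
have [->|y0] := eqVneq y 0; first by rewrite mul0r powR_ge0.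
have {}y0 : 0 < y by rewrite lt0r y0 normr_ge0.
rewrite -(mulr_powRB1 (ltW y0) p0).
rewrite ler_wpM2l ?(ltW y0)// /powR !gt_eqF// ler_expR.
by rewrite ler_wnM2l ?ler_ln ?posrE//; lra.
Unshelve. all: by end_near. Qed.

End CriticalExponent.

Theorem theorem2p4 (R : realType) (x : R -> R)
    (x_continuous : {within `[0, 1], continuous x})
    (x_nonconstant : exists s t : R,
       [/\ s \in `[0, 1], t \in `[0, 1] & x s != x t]) :
  (reverse_jensen_condition x ->
   forall r : R,
     admits_roughness_exponent x r <->
     roughness_estimate x n @[n --> \oo] --> r) /\
  (forall r : R, 0 < r ->
     admits_roughness_exponent x r ->
     roughness_estimate x n @[n --> \oo] --> r ->
     reverse_jensen_at x r^-1).
Proof.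
have sl := exists_slope_neq0 x_continuous x_nonconstant.
have l2 : 0 < ln 2 :> R by rewrite ln_gt0// ltr1n.
have est_sublinear p r : roughness_estimate x n @[n --> \oo] --> r ->
    sublinear (fun n => n%:R * (ln 2 * p * (r - roughness_estimate x n))).
  move=> /cvgrPdist_le Hr; apply/sublinearP => e e0.
  have d0 : 0 < `|ln 2 * p| + 1 by rewrite ltr_wpDl.
  have ed : 0 < e / (`|ln 2 * p| + 1) by rewrite divr_gt0.
  near=> n; have h : `|r - roughness_estimate x n| <= e / (`|ln 2 * p| + 1).
    by near: n; exact: Hr.
  rewrite normrM ger0_norm// mulrC ler_wpM2r// normrM.
  apply: le_trans (ler_wpM2l (normr_ge0 _) h) _.
  by rewrite mulrCA ler_piMr ?(ltW e0)// ler_pdivrMr// mul1r lerDl.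
split=> [RJ r|r r0 /admits_roughness_exponentP[/andP[_ r1] V0 Vy] Hr].
  have rate p (p1 : 1 <= p) :=
    iffLR (reverse_jensen_atP_pvariation p1 sl) (RJ p p1).
  split=> [/admits_roughness_exponentP[/andP[r0 r1] V0 Vy]|Hr].
    apply/cvgrPdist_le => e e0; have e2 : 0 < e / 2 by lra.
    (* The exponents used have inverses [r - e / 2] and [r + e / 2], one on
       each side of [r]. When such an inverse leaves the unit interval, the
       general bounds on the estimate apply instead. *)
    have lo : \forall n \near \oo, r - e <= roughness_estimate x n.
      have [re|re] := leP (r - e / 2) 0.
        apply: filterS (near_roughness_estimate_ge0 x_continuous e2) => n; lra.
      have p1 : 1 <= (r - e / 2)^-1 by rewrite invf_ge1//; lra.
      have p0 : 0 < (r - e / 2)^-1 by rewrite invr_gt0.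
      have V1 : \forall n \near \oo, pvariation x (r - e / 2)^-1 n <= 1.
        have pr : 1 < (r - e / 2)^-1 * r by rewrite ltr_pdivlMl//; lra.
        exact: (cvgr_le _ (V0 _ p0 pr) _ ltr01).
      apply: filterS (roughness_estimate_ge p0 e2 (rate _ p1) V1) => n.
      by rewrite invrK; lra.
    have hi : \forall n \near \oo, roughness_estimate x n <= r + e.
      have [re|re] := leP 1 (r + e / 2).
        apply: filterS (near_roughness_estimate_le1 x e2) => n; lra.
      have re0 : 0 < r + e / 2 by lra.
      have p1 : 1 <= (r + e / 2)^-1 by rewrite invf_ge1//; lra.
      have p0 : 0 < (r + e / 2)^-1 by rewrite invr_gt0.
      have V1 : \forall n \near \oo, 1 <= pvariation x (r + e / 2)^-1 n.
        have pr : (r + e / 2)^-1 * r < 1 by rewrite ltr_pdivrMl//; lra.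
        exact: (iffLR (cvgryPge _) (Vy _ p0 pr)).
      apply: filterS (roughness_estimate_le p0 e2 (rate _ p1) V1) => n.
      by rewrite invrK; lra.
    near=> n; rewrite distrC ler_distl; apply/andP.
    by split; near: n.
  have r0 : 0 <= r.
    apply/ler_addgt0Pl => e e0; rewrite -lerBlDl sub0r.
    exact: (cvgr_to_ge Hr (near_roughness_estimate_ge0 x_continuous e0)).
  have r1 : r <= 1.
    apply/ler_addgt0Pl => e e0; rewrite addrC.
    exact: (cvgr_to_le Hr (near_roughness_estimate_le1 x e0)).
  have ratelim p : 1 <= p -> sublinear (fun n => ln (pvariation x p n) -
      n%:R * (ln 2 * (1 - p * r))).
    move=> p1; have := sublinearD (rate p p1) (est_sublinear p r Hr).
    by congr sublinear; apply/funext => n; ring.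
  apply/admits_roughness_exponentP; split => [|p p0 pr|p p0 pr].
  - by rewrite r0.
  - apply: (cvg0_of_rate _ _ (ratelim p _)).
    + by move=> n; exact: pvariation_ge0.
    + by rewrite pmulr_rlt0// subr_lt0.
    + by nra.
  - have [p1|p1] := leP 1 p; last exact: pvariation_lt1_cvgy.
    by apply: (cvgy_of_rate _ (ratelim p p1)); rewrite mulr_gt0// subr_gt0.
have q1 : 1 <= r^-1 by rewrite invf_ge1.
have q0 : 0 < r^-1 by rewrite invr_gt0.
apply/(reverse_jensen_atP_pvariation q1 sl).
have sV : sublinear (fun n => ln (pvariation x r^-1 n)).
  apply: pvariation_critical_sublinear => // [|p p0 h|p p0 h].
  - exact: near_pvariation_gt0.
  - by apply: V0 => //; rewrite -ltr_pdivrMr// div1r.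
  - by apply: Vy => //; rewrite -ltr_pdivlMr// div1r.
have := sublinearB sV (est_sublinear r^-1 r Hr); congr sublinear.
apply/funext => n; congr (_ - _ * _).
by rewrite -mulrA mulrBr mulVf// gt_eqF.
Unshelve. all: by end_near. Qed.
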